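(* Let $H$ be a pointed Hopf algebra over a field $\mathbb{K}$ with invertible antipode and finite group $G=G(H)$ of grouplike elements, and let $A$ be a symmetric partial left $H$-module algebra. If $X_1,X_2,\dots,X_n$ is a complete set of representatives in $\mathcal{P}_1(G)$ for the equivalence relation $\sim$, then $$A=\bigoplus_{k=1}^{n}A\,\Gamma^A_{X_k},$$ where $A\,\Gamma^A_{X_k}$ is the ideal of $A$ generated by $\Gamma^A_{X_k}$, which is stable under the left partial action of $H$, for all $k=1,\dots,n$. Moreover, for every $X\in\mathcal{P}_1(G)$, every $a\in A$ and every $h\in H$, $$h\cdot(a\Gamma^A_X)=(h\cdot a)\Gamma^A_X.$$
   Context: Sweedler notation $\Delta(h)=h_{1}\otimes h_{2}$ is used. A Hopf algebra is pointed if all its simple subcoalgebras are one-dimensional. A symmetric partial left $H$-module algebra is a unital algebra $A$ with a linear map $H\otimes A\to A$, $h\otimes a\mapsto h\cdot a$, such that for all $h,k\in H$, $a,b\in A$: $1_H\cdot a=a$; $h\cdot(ab)=(h_1\cdot a)(h_2\cdot b)$; $h\cdot(k\cdot a)=(h_1\cdot 1_A)(h_2k\cdot a)$; and $h\cdot(k\cdot a)=(h_1k\cdot a)(h_2\cdot 1_A)$. $\mathcal{P}_1(G)=\{X\subseteq G\mid 1_H\in X\}$. For $X\in\mathcal{P}_1(G)$, $$P^A_X=\prod_{x\in X}(x\cdot 1_A)\prod_{y\in G\setminus X}(1_A-(y\cdot 1_A))$$ (each $g\cdot 1_A$, $g\in G$, is a central idempotent of $A$). For $X,Y\in\mathcal{P}_1(G)$,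 $X\sim Y$ if there exists $g\in G$ with $g^{-1}\in X$ and $gX=Y$; this is an equivalence relation. For $X\in\mathcal{P}_1(G)$, $\Gamma^A_X=\sum_{Y\sim X}P^A_Y$. *)

(* Defs.v *)
From HB Require Import structures.
From mathcomp Require Import all_boot all_algebra generic_quotient finmap.
From mathcomp Require Import boolp classical_sets cardinality.

Set Implicit Arguments.
Unset Strict Implicit.
Unset Printing Implicit Defensive.

Import GRing.Theory.
Local Open Scope quotient_scope.
Local Open Scope ring_scope.

(** * Tensor product of (possibly infinite-dimensional) vector spaces *)

(* [tcong] is the congruence generated by the bilinearity relations on the free
   commutative monoid of formal sums of pure tensors, a formal sum being a
   sequence of pairs; its quotient is the tensor product. *)
Inductive tcong (K : fieldType) (U V : lmodType K) :
    seq (U * V) -> seq (U * V) -> Prop :=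
| tcong_refl s : tcong s s
| tcong_sym s t : tcong s t -> tcong t s
| tcong_trans s t r : tcong s t -> tcong t r -> tcong s r
| tcong_cat s s' t t' : tcong s s' -> tcong t t' -> tcong (s ++ t) (s' ++ t')
| tcong_comm s t : tcong (s ++ t) (t ++ s)
| tcong_addl u u' v : tcong [:: (u + u', v)] [:: (u, v); (u', v)]
| tcong_addr u v v' : tcong [:: (u, v + v')] [:: (u, v); (u, v')]
| tcong_scale a u v : tcong [:: (a *: u, v)] [:: (u, a *: v)]
| tcong_zero v : tcong [:: (0, v)] [::].

Section Tensor.
Variables (K : fieldType) (U V : lmodType K).
Implicit Types (s t : seq (U * V)) (a b : K).

Definition tcongb (s t : seq (U * V)) : bool := `[< tcong s t >].

Lemma tcongb_refl : reflexive tcongb.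
Proof. by move=> s; apply/asboolP; exact: tcong_refl. Qed.

Lemma tcongb_sym : symmetric tcongb.
Proof. by move=> s t; apply/asbool_equiv_eq; split; exact: tcong_sym. Qed.

Lemma tcongb_trans : transitive tcongb.
Proof.
move=> t s r /asboolP st /asboolP tr.
by apply/asboolP; exact: tcong_trans st tr.
Qed.

Canonical tcong_equiv := EquivRel tcongb tcongb_refl tcongb_sym tcongb_trans.

Definition tensor := {eq_quot tcong_equiv}.
HB.instance Definition _ := Choice.on tensor.
HB.instance Definition _ := EqQuotient.on tensor.

Lemma tensorP s t : (\pi_tensor s = \pi_tensor t) <-> tcong s t.
Proof.
split; first by move/eqmodP/asboolP.
by move=> st; apply/eqmodP/asboolP.
Qed.

Definition tscale_seq a s := [seq (a *: p.1, p.2) | p <- s].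

Lemma tcong_scale_seq a s t : tcong s t -> tcong (tscale_seq a s) (tscale_seq a t).
Proof.
elim => {s t} /=; rewrite /tscale_seq.
- by move=> s; exact: tcong_refl.
- by move=> s t _; exact: tcong_sym.
- by move=> s t r _ st _; exact: tcong_trans.
- by move=> s s' t t' _ ss' _ tt'; rewrite !map_cat; exact: tcong_cat.
- by move=> s t; rewrite !map_cat; exact: tcong_comm.
- by move=> u u' v /=; rewrite scalerDr; exact: tcong_addl.
- by move=> u v v' /=; exact: tcong_addr.
- by move=> b u v /=; rewrite scalerA mulrC -scalerA; exact: tcong_scale.
- by move=> v /=; rewrite scaler0; exact: tcong_zero.
Qed.

Definition tadd (x y : tensor) : tensor := \pi_tensor (repr x ++ repr y).
Definition tscale a (x : tensor) : tensor := \pi_tensor (tscale_seq a (repr x)).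
Definition tzero : tensor := \pi_tensor [::].
Definition topp (x : tensor) : tensor := tscale (-1) x.

Lemma repr_pi s : tcong (repr (\pi_tensor s)) s.
Proof. by apply/tensorP; rewrite reprK. Qed.

Lemma tadd_pi s t : tadd (\pi_tensor s) (\pi_tensor t) = \pi_tensor (s ++ t).
Proof. by apply/tensorP; apply: tcong_cat; exact: repr_pi. Qed.

Lemma tscale_pi a s : tscale a (\pi_tensor s) = \pi_tensor (tscale_seq a s).
Proof. by apply/tensorP; apply: tcong_scale_seq; exact: repr_pi. Qed.

Lemma taddA : associative tadd.
Proof.
elim/quotW=> x; elim/quotW=> y; elim/quotW=> z.
by rewrite (tadd_pi y z) (tadd_pi x y) !tadd_pi catA.
Qed.

Lemma taddC : commutative tadd.
Proof. by move=> x y; rewrite /tadd; apply/tensorP; exact: tcong_comm. Qed.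

Lemma tadd0 : left_id tzero tadd.
Proof. by elim/quotW=> s; rewrite /tzero tadd_pi. Qed.

Lemma tscaleA a b x : tscale a (tscale b x) = tscale (a * b) x.
Proof.
elim/quotW: x => s; rewrite (tscale_pi b s) !tscale_pi /tscale_seq -map_comp.
by congr (\pi_tensor _); apply: eq_map => p /=; rewrite scalerA.
Qed.

Lemma tscale1 : left_id 1 tscale.
Proof.
elim/quotW=> s; rewrite tscale_pi; congr (\pi_tensor _).
by rewrite /tscale_seq -[RHS]map_id; apply: eq_map => -[u v] /=; rewrite scale1r.
Qed.

Lemma tscaleDr : right_distributive tscale tadd.
Proof.
move=> a; elim/quotW=> s; elim/quotW=> t.
rewrite (tadd_pi s t) (tscale_pi a s) (tscale_pi a t) tscale_pi tadd_pi.
by rewrite /tscale_seq map_cat.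
Qed.

Lemma tscaleDl x : {morph tscale^~ x : a b / a + b >-> tadd a b}.
Proof.
move=> a b; elim/quotW: x => s.
rewrite (tscale_pi a s) (tscale_pi b s) tscale_pi tadd_pi; apply/tensorP.
elim: s => [|[u v] s IHs] /=; first exact: tcong_refl.
rewrite scalerDl.
apply: tcong_trans (tcong_cat (tcong_addl (a *: u) (b *: u) v) IHs) _ => /=.
have := tcong_cat (tcong_comm [:: (b *: u, v)] (tscale_seq a s))
                  (tcong_refl (tscale_seq b s)).
move/(tcong_cat (tcong_refl [:: (a *: u, v)])).
by rewrite -!catA.
Qed.

Lemma tscale0 x : tscale 0 x = tzero.
Proof.
elim/quotW: x => s; rewrite tscale_pi; apply/tensorP.
elim: s => [|[u v] s IHs] /=; first exact: tcong_refl.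
by rewrite scale0r; exact: (tcong_cat (@tcong_zero K U V v) IHs).
Qed.

Lemma taddN : left_inverse tzero topp tadd.
Proof.
move=> x; rewrite /topp -[x in X in tadd _ X]tscale1 -tscaleDl.
by rewrite addNr tscale0.
Qed.

HB.instance Definition _ :=
  GRing.isZmodule.Build tensor taddA taddC tadd0 taddN.
HB.instance Definition _ :=
  GRing.Zmodule_isLmodule.Build K tensor tscaleA tscale1 tscaleDr tscaleDl.

Definition tens (u : U) (v : V) : tensor := \pi_tensor [:: (u, v)].

(* Sweedler summation: the sum of [F u v] over the terms of a chosen expression
   of [x] as a sum of pure tensors.  By [tsum_tens] and [tsum_linear] below, for
   bilinear [F] this is the linear map induced by [F], so the choice is
   immaterial.  All the uses below have a bilinear [F]. *)
Definition tsum (W : zmodType) (F : U -> V -> W) (x : tensor) : W :=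
  \sum_(p <- repr x) F p.1 p.2.

Definition bilin (W : lmodType K) (F : U -> V -> W) :=
  (forall v, linear (F^~ v)) /\ (forall u, linear (F u)).

Lemma tensor_repr x : x = tsum tens x.
Proof.
rewrite /tsum -[LHS]reprK; elim: (repr x) => [|[u v] s IHs].
  by rewrite big_nil.
by rewrite big_cons -IHs /= -cat1s -[RHS]/(tadd _ _) tadd_pi.
Qed.

Lemma tens_bilin : bilin tens.
Proof.
have Zl a u v : tens (a *: u) v = a *: tens u v.
  by rewrite -[RHS]/(tscale _ _) tscale_pi.
split=> [v a u u' | u a v v'].
  rewrite -Zl -[RHS]/(tadd _ _) tadd_pi; apply/tensorP; exact: tcong_addl.
rewrite -Zl -[RHS]/(tadd _ _) tadd_pi; apply/tensorP.
apply: tcong_trans (tcong_addr _ _ _) _.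
apply: (@tcong_cat _ _ _ [:: _] [:: _] [:: _] [:: _]); last exact: tcong_refl.
by apply: tcong_sym; exact: tcong_scale.
Qed.

Section UniversalProperty.
Variables (W : lmodType K) (F : U -> V -> W).
Hypothesis bilinF : bilin F.

Lemma tsum_cong s t : tcong s t ->
  \sum_(p <- s) F p.1 p.2 = \sum_(p <- t) F p.1 p.2.
Proof.
have [Fl Fr] := bilinF.
have Dl u u' v : F (u + u') v = F u v + F u' v.
  by have := Fl v 1 u u'; rewrite !scale1r.
have Dr u v v' : F u (v + v') = F u v + F u v'.
  by have := Fr u 1 v v'; rewrite !scale1r.
have F0l v : F 0 v = 0.
  by apply: (addrI (F 0 v)); rewrite -Dl !addr0.
have F0r u : F u 0 = 0.
  by apply: (addrI (F u 0)); rewrite -Dr !addr0.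
have Zl a u v : F (a *: u) v = a *: F u v.
  by have := Fl v a u 0; rewrite F0l !addr0.
have Zr a u v : F u (a *: v) = a *: F u v.
  by have := Fr u a v 0; rewrite F0r !addr0.
elim=> {s t} //=.
- by move=> s t r _ -> _ ->.
- by move=> s s' t t' _ ss' _ tt'; rewrite !big_cat /= ss' tt'.
- by move=> s t; rewrite !big_cat /= addrC.
- by move=> u u' v; rewrite !big_cons !big_nil /= !addr0 Dl.
- by move=> u v v'; rewrite !big_cons !big_nil /= !addr0 Dr.
- by move=> a u v; rewrite !big_seq1 /= Zl Zr.
- by move=> v; rewrite big_seq1 big_nil /= F0l.
Qed.

Lemma tsum_tens u v : tsum F (tens u v) = F u v.
Proof. by rewrite /tsum (tsum_cong (repr_pi _)) big_seq1. Qed.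

Lemma tsum_linear : linear (tsum F).
Proof.
have [Fl _] := bilinF.
have F0l v : F 0 v = 0.
  by apply: (addrI (F 0 v)); have := Fl v 1 0 0; rewrite !scale1r !addr0 => <-.
have Zl a u v : F (a *: u) v = a *: F u v.
  by have := Fl v a u 0; rewrite F0l !addr0.
move=> a x y; rewrite /tsum (tsum_cong (repr_pi _)) big_cat /=; congr (_ + _).
rewrite (tsum_cong (repr_pi _)) big_map scaler_sumr.
by apply: eq_bigr => p _ /=; rewrite Zl.
Qed.

End UniversalProperty.

End Tensor.

Notation "u \ox v" := (tens u v) (at level 40, left associativity) : ring_scope.
Notation "\tsum_ ( x , y <- t ) F" := (tsum (fun x y => F) t)
  (at level 36, F at level 41, x name, y name,
   format "\tsum_ ( x ,  y  <-  t )  F") : ring_scope.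

(** * Coalgebras and Hopf algebras *)

HB.mixin Record isCoalgebra (K : fieldType) C of GRing.Lmodule K C := {
  comul : {linear C -> tensor C C};
  counit : {scalar C};
  comulA : forall c : C,
    \tsum_(x, y <- comul c) (\tsum_(x1, x2 <- comul x) x1 \ox (x2 \ox y))
    = \tsum_(x, y <- comul c) x \ox comul y;
  counitl : forall c : C, \tsum_(x, y <- comul c) counit x *: y = c;
  counitr : forall c : C, \tsum_(x, y <- comul c) counit y *: x = c
}.

#[short(type="coalgType")]
HB.structure Definition Coalgebra (K : fieldType) :=
  {C of isCoalgebra K C & GRing.Lmodule K C}.

HB.mixin Record isHopf (K : fieldType) H
    of GRing.Algebra K H & Coalgebra K H := {
  comul1 : comul (1 : H) = 1 \ox 1;
  comulM : forall h k : H, comul (h * k) =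
    \tsum_(h1, h2 <- comul h) \tsum_(k1, k2 <- comul k) (h1 * k1) \ox (h2 * k2);
  counit1 : counit (1 : H) = 1;
  counitM : forall h k : H, counit (h * k) = counit h * counit k;
  antipode : {linear H -> H};
  antipodel : forall h : H,
    \tsum_(h1, h2 <- comul h) (antipode h1 * h2) = counit h *: 1;
  antipoder : forall h : H,
    \tsum_(h1, h2 <- comul h) (h1 * antipode h2) = counit h *: 1
}.

#[short(type="hopfType")]
HB.structure Definition Hopf (K : fieldType) :=
  {H of isHopf K H & GRing.Algebra K H & Coalgebra K H}.

Local Open Scope classical_set_scope.

Section Pointed.
Variables (K : fieldType) (C : coalgType K).

Definition subspace (D : set C) :=
  D 0 /\ forall (a : K) (x y : C), D x -> D y -> D (a *: x + y).

(* The second clause says that [comul] maps [D] to the image of [D (x) D] in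
   [C (x) C]. *)
Definition subcoalgebra (D : set C) :=
  subspace D /\
  forall c, D c -> exists s : seq (C * C),
    (forall p, p \in s -> D p.1 /\ D p.2) /\
    comul c = \sum_(p <- s) p.1 \ox p.2.

Definition simple_subcoalgebra (D : set C) :=
  [/\ subcoalgebra D, D <> [set 0] &
      forall E : set C, subcoalgebra E -> E `<=` D -> E = [set 0] \/ E = D].

Definition one_dimensional (D : set C) :=
  exists v : C, v <> 0 /\ D = [set a *: v | a in [set: K]].

Definition pointed :=
  forall D : set C, simple_subcoalgebra D -> one_dimensional D.

Definition grouplike : set C := [set g | g <> 0 /\ comul g = g \ox g].

End Pointed.

(** * Symmetric partial actions *)

Definition symmetric_partial_action (K : fieldType) (H : hopfType K)
    (A : algType K) (act : {linear tensor H A -> A}) :=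
  let dot (h : H) (a : A) : A := act (h \ox a) in
  [/\ forall a, dot 1 a = a,
      forall h a b, dot h (a * b) =
        \tsum_(h1, h2 <- comul h) (dot h1 a * dot h2 b),
      forall h k a, dot h (dot k a) =
        \tsum_(h1, h2 <- comul h) (dot h1 1 * dot (h2 * k) a) &
      forall h k a, dot h (dot k a) =
        \tsum_(h1, h2 <- comul h) (dot (h1 * k) a * dot h2 1)].

Section Grouplikes.
Variables (K : fieldType) (H : hopfType K).

(* [G(H)] as a finite set; it is meaningful only when [grouplike H] is finite. *)
Definition Gset : {fset H} := fset_set (@grouplike K H).

Definition P1 (X : {fset H}) : Prop := (X `<=` Gset)%fset /\ 1 \in X.

(* [g'] is the inverse of [g] in [G(H)]. *)
Definition trans_equiv (X Y : {fset H}) : Prop :=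
  exists g g' : H,
    [/\ g \in Gset, g' \in Gset, g * g' = 1, g' * g = 1 &
        g' \in X /\ [fset g * x | x in X]%fset = Y].

Definition complete_representatives (n : nat) (X : 'I_n -> {fset H}) :=
  (forall k, P1 (X k)) /\
  forall Y, P1 Y -> exists! k, trans_equiv Y (X k).

Variables (A : algType K) (act : {linear tensor H A -> A}).

(* The factors are central idempotents, so the order of the factors, given by
   the enumeration of the finite sets, is immaterial. *)
Definition Pidem (X : {fset H}) : A :=
  (\prod_(x <- X) act (x \ox 1)) *
  (\prod_(y <- (Gset `\` X)%fset) (1 - act (y \ox 1))).

Definition Gam (X : {fset H}) : A :=
  \sum_(Y <- fpowerset Gset | `[< P1 Y /\ trans_equiv Y X >]) Pidem Y.

End Grouplikes.

(** * Ideals and direct sums *)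

Definition two_sided_ideal (A : nzRingType) (I : set A) :=
  [/\ I 0, forall x y, I x -> I y -> I (x - y) &
      forall a x, I x -> I (a * x) /\ I (x * a)].

Definition internal_direct_sum (A : zmodType) (n : nat) (I : 'I_n -> set A) :=
  forall a : A, exists! b : {ffun 'I_n -> A},
    (forall k, I k (b k)) /\ a = \sum_k b k.

(* Main.v *)
Require Import Defs.
From HB Require Import structures.
From mathcomp Require Import all_boot all_algebra generic_quotient finmap.
From mathcomp Require Import boolp classical_sets cardinality.
Import GRing.Theory.
Local Open Scope classical_set_scope.
Local Open Scope ring_scope.

Set Implicit Arguments.
Unset Strict Implicit.
Unset Printing Implicit Defensive.

(** The elements [Gam act X], one for each class of [P1], are orthogonal central
    idempotents of [A] with sum 1, so the direct sum decomposition is the one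
    attached to any such family; it rests on the elements [act (g \ox 1)], with [g]
    grouplike, being central idempotents.  The content of the theorem is
    that the action of [H] does not move a block into another one:
    [act (h \ox e) = act (h \ox 1) * e] for [e := Gam act X] ([act_Gam]), from
    which compatibility with [a * e] follows by multiplicativity.

    For [h = g] grouplike one looks at a single pair of blocks: the product
    [act (g \ox Pidem act Y) * Pidem act Z] is zero unless the inverse of [g] is in
    [Y] and [Z = g Y], that is, unless [Y ~ Z] by way of [g] ([act_Pidem_neq0]).
    With [f := 1 - e] this gives [act (g \ox e) * f = 0] and
    [act (g \ox f) * e = 0].

    To pass from grouplikes to all of [H], consider [d h := act (h \ox e) * f].  As
    [e] and [f] are idempotent and [f] is central, [d] is an idempotent of the
    convolution algebra Hom(H, A), and it vanishes on grouplikes.  On a pointed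
    coalgebra such a [d] is zero ([conv_idempotent_eq0]); morally, [d] vanishes on
    the coradical, hence is locally nilpotent.  This is proved without the coradical
    filtration.  Every element is a combination of the entries of a matrix [c] with
    comul c_ij = sum_k c_ik \ox c_kj, that is, of the coefficient matrix of a
    finite-dimensional comodule ([in_comultiplicative_span]), and then the matrix
    [d c] is idempotent.  If the comodule has a proper nonzero subcomodule, [c]
    becomes block triangular with comultiplicative diagonal blocks, to which
    induction on the size applies: [d c] is idempotent and strictly block
    triangular, hence zero.  If the comodule is simple, its coefficients span a
    simple subcoalgebra ([irreducible_subcoalgebra]), which is a line because the
    coalgebra is pointed; then [c] is a grouplike times the identity matrix and
    [d c = 0].

    The coalgebra arguments are carried out on the side of linear functionals, of
    which there are enough by Zorn's lemma ([exists_functional],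
    [tensor_separation]): evaluating a comultiplicative matrix at functionals turns
    convolution into products of scalar matrices. *)

(** * Bilinear maps and Sweedler sums *)

(** Several lemmas below produce linear maps as plain functions with a proof of
    linearity; this packages them so that the theory of linear maps applies. *)
Definition lin_of (K : fieldType) (U V : lmodType K) (f : U -> V)
    (lf : linear f) : {linear U -> V} :=
  HB.pack f (GRing.isLinear.Build K U V *:%R f lf).

Lemma bilin_comp (K : fieldType) (U V U' V' W : lmodType K) (F : U -> V -> W)
    (f : {linear U' -> U}) (g : {linear V' -> V}) :
  bilin F -> bilin (fun x y => F (f x) (g y)).
Proof.
by move=> [Fl Fr]; split=> [v a u u'|u a v v'] /=; rewrite linearP (Fl, Fr).
Qed.

Lemma mul_bilin (K : fieldType) (A : algType K) :
  bilin (fun a b : A => a * b).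
Proof.
split=> [v a u u'|u a v v']; first by rewrite mulrDl scalerAl.
by rewrite mulrDr scalerAr.
Qed.

Lemma raddf_tsum (K : fieldType) (U V : lmodType K) (W W' : zmodType)
   (L : {additive W -> W'}) (F : U -> V -> W) t :
  L (tsum F t) = tsum (fun x y => L (F x y)) t.
Proof. by rewrite /tsum raddf_sum. Qed.

Lemma eq_tsum (K : fieldType) (U V : lmodType K) (W : zmodType)
   (F G : U -> V -> W) t :
  (forall x y, F x y = G x y) -> tsum F t = tsum G t.
Proof. by move=> FG; apply: eq_bigr. Qed.

Lemma tsum_sum (K : fieldType) (U V : lmodType K) (W : lmodType K)
    (F : U -> V -> W) I (r : seq I) P (t : I -> tensor U V) :
  bilin F -> tsum F (\sum_(i <- r | P i) t i) = \sum_(i <- r | P i) tsum F (t i).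
Proof. move=> bF; exact: (raddf_sum (lin_of (tsum_linear bF))). Qed.

Lemma tsum_pure (K : fieldType) (U V : lmodType K) (W : lmodType K)
    (F : U -> V -> W) I (r : seq I) P u v :
  bilin F -> tsum F (\sum_(i <- r | P i) u i \ox v i)
  = \sum_(i <- r | P i) F (u i) (v i).
Proof. by move=> bF; rewrite tsum_sum //; apply: eq_bigr => i _; rewrite tsum_tens. Qed.

(** * Separation by linear functionals *)

(** Take a subspace [N] maximal among those that contain [W] and avoid [v].  By
    maximality [N] together with any further vector generates [v], so the space is
    the direct sum of [N] and the line of [v]; the functional is the coordinate
    along [v]. *)
Lemma exists_functional (K : fieldType) (C : lmodType K) (W : set C) (v : C) :
  W 0 -> (forall (a : K) x y, W x -> W y -> W (a *: x + y)) -> ~ W v ->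
  exists2 f : {linear C -> K^o}, (forall w, W w -> f w = 0) & f v = 1.
Proof.
move=> W0 Wlin Wv.
pose ssp (D : set C) := D 0 /\ forall (a : K) (x y : C), D x -> D y -> D (a *: x + y).
(* Adding [W] to [S] makes the condition hold for the union of the empty chain. *)
pose P (S : set C) := ssp (W `|` S) /\ ~ S v.
have [F FP Ftot|M [[[_ MS] Mv] Mmax]] := @Zorn_bigcup C P.
  split; last by move=> [S FS Sv]; exact: (FP S FS).2 Sv.
  split; first by left.
  have key S x y a : F S -> (W `|` S) x -> (W `|` S) y ->
      (W `|` \bigcup_(X in F) X) (a *: x + y).
    move=> FS Sx Sy; have [|?] := (FP S FS).1.2 a x y Sx Sy; [by left|].
    by right; exists S.
  move=> a x y [Wx|[S FS Sx]] [Wy|[T FT Ty]].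
  - by left; exact: Wlin.
  - by apply: (key T) => //; [left|right].
  - by apply: (key S) => //; [right|left].
  - have [ST|TS] := Ftot S T FS FT.
      by apply: (key T) => //; right => //; exact: ST.
    by apply: (key S) => //; right => //; exact: TS.
set N := W `|` M in MS.
have N0 : N 0 by left.
have Nv : ~ N v by case.
have NZ a x : N x -> N (a *: x) by move=> Nx; rewrite -[_ *: _]addr0; exact: MS.
have ND x y : N x -> N y -> N (x + y) by rewrite -{2}[x]scale1r; exact: MS.
have NN x : N x -> N (- x) by rewrite -scaleN1r; exact: NZ.
have ex x : exists a : K, N (x - a *: v).
  have [Nx|Nx] := pselect (N x); first by exists 0; rewrite scale0r subr0.
  pose B : set C := [set y | exists a, N (y - a *: x)].
  have NB : N `<=` B by move=> y Ny; exists 0; rewrite scale0r subr0.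
  have WBB : W `|` B = B by rewrite setUidr // => y Wy; apply: NB; left.
  have [Bv|Bv] := pselect (B v); last first.
    (* If [N] and [x] did not generate [v], their span would contradict maximality. *)
    case: (Mmax B) => //; last first.
      split=> //; rewrite WBB; split; first exact: NB.
      move=> a y z [b yb] [c zc]; exists (a * b + c).
      rewrite scalerDl opprD addrACA -scalerA -scalerBr.
      by apply: ND => //; exact: NZ.
    split; first by move=> y My; apply: NB; right.
    move=> BM; apply: Nx; right; apply: BM; exists 1.
    by rewrite scale1r subrr.
  have [a va] := Bv.
  have a0 : a != 0.
    by apply/eqP => a0; move: va; rewrite a0 scale0r subr0.
  exists a^-1; move/(NZ (- a^-1)): va.
  rewrite scalerBr scalerA mulNr mulVf // scaleN1r opprK scaleNr.
  by rewrite addrC.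
have uniq x a b : N (x - a *: v) -> N (x - b *: v) -> a = b.
  move=> xa xb; apply: contrapT => /eqP; rewrite -subr_eq0 => ab.
  apply: Nv; rewrite -[v]scale1r -(mulVf ab) -scalerA; apply: NZ.
  have := ND _ _ xb (NN _ xa).
  by rewrite opprB addrC addrA subrK -scalerBl.
pose f x : K^o := sval (cid (ex x)).
have fP x : N (x - f x *: v) := svalP (cid (ex x)).
have flin : linear f.
  move=> a x y; apply: (uniq (a *: x + y)) => //.
  rewrite scalerDl opprD addrACA -scalerA -scalerBr.
  by apply: ND => //; exact: NZ.
exists (lin_of flin) => [w Ww|] /=.
  by apply: (uniq w) => //; rewrite scale0r subr0; left.
by apply: (uniq v) => //; rewrite scale1r subrr.
Qed.

(** Separate [v k] from the span of the other vectors. *)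
Lemma dual_or_dependent (K : fieldType) (U : lmodType K) n (v : 'I_n.+1 -> U) k :
  (exists p : {linear U -> K^o}, forall j, p (v j) = (k == j)%:R) \/
  (exists a : 'I_n -> K, v k = \sum_i a i *: v (lift k i)).
Proof.
pose W : set U := [set x | exists a : 'I_n -> K, x = \sum_i a i *: v (lift k i)].
have [Wv|Wv] := pselect (W (v k)); [by right|left].
have [||p pW pv] := @exists_functional _ _ W (v k) _ _ Wv.
- by exists (fun=> 0); rewrite big1 // => i _; rewrite scale0r.
- move=> a _ _ [b ->] [c ->]; exists (fun i => a * b i + c i).
  by rewrite scaler_sumr -big_split; apply: eq_bigr => i _; rewrite scalerDl scalerA.
exists p => j; have [<-|kj] := eqVneq k j; first exact: pv.
have [i -> _] := unlift_some kj; rewrite /= mulr0n; apply: pW.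
exists (fun l => (i == l)%:R); rewrite (bigD1 i) //= eqxx scale1r big1 ?addr0 // => l.
by rewrite eq_sym => /negPf ->; rewrite scale0r.
Qed.

(** An expression with the least number of pure tensors has linearly independent
    factors on both sides, since a dependency would let one term be absorbed by the others. *)
Lemma tensor_dual_basis (K : fieldType) (U V : lmodType K) (t : tensor U V) :
  exists (n : nat) (v : 'I_n -> U) (w : 'I_n -> V)
    (p : 'I_n -> {linear U -> K^o}) (q : 'I_n -> {linear V -> K^o}),
  [/\ t = \sum_i v i \ox w i, forall i j, p i (v j) = (i == j)%:R
    & forall i j, q i (w j) = (i == j)%:R].
Proof.
pose P n := `[< exists (v : 'I_n -> U) (w : 'I_n -> V), t = \sum_i v i \ox w i >].
have exP : exists n, P n.
  exists (size (repr t)); apply/asboolP.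
  exists (fun i => (tnth (in_tuple (repr t)) i).1).
  exists (fun i => (tnth (in_tuple (repr t)) i).2).
  by rewrite [LHS]tensor_repr /tsum big_tnth.
have [n /asboolP[v [w tE]] nmin] := ex_minnP exP.
have [tDl tDr] := @tens_bilin K U V.
have Zr a (u : U) (x : V) : u \ox (a *: x) = a *: (u \ox x).
  exact: (linearZ_LR (lin_of (tDr u))).
have Zl a (u : U) (x : V) : (a *: u) \ox x = a *: (u \ox x).
  exact: (linearZ_LR (lin_of (tDl x))).
have Dr (u : U) (x y : V) : u \ox (x + y) = u \ox x + u \ox y.
  exact: (linearD (lin_of (tDr u))).
have Dl (u y : U) (x : V) : (u + y) \ox x = u \ox x + y \ox x.
  exact: (linearD (lin_of (tDl x))).
have Sr (u : U) m (x : 'I_m -> V) : u \ox (\sum_i x i) = \sum_i u \ox x i.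
  exact: (linear_sum (lin_of (tDr u))).
have Sl (u : V) m (x : 'I_m -> U) : (\sum_i x i) \ox u = \sum_i x i \ox u.
  exact: (linear_sum (lin_of (tDl u))).
have exp k : exists p : {linear U -> K^o}, forall j, p (v j) = (k == j)%:R.
  case: n v w tE nmin k => [|n] v w tE nmin k; first by case: k.
  have [//|[a vk]] := dual_or_dependent v k.
  suff /nmin : P n by rewrite ltnn.
  apply/asboolP; exists (fun i => v (lift k i)), (fun i => w (lift k i) + a i *: w k).
  rewrite tE (bigD1_ord k) //= vk Sl -big_split; apply: eq_bigr => i _ /=.
  by rewrite Dr Zl Zr addrC.
have exq k : exists q : {linear V -> K^o}, forall j, q (w j) = (k == j)%:R.
  case: n v w tE nmin k {exp} => [|n] v w tE nmin k; first by case: k.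
  have [//|[a wk]] := dual_or_dependent w k.
  suff /nmin : P n by rewrite ltnn.
  apply/asboolP; exists (fun i => v (lift k i) + a i *: v k), (fun i => w (lift k i)).
  rewrite tE (bigD1_ord k) //= wk Sr -big_split; apply: eq_bigr => i _ /=.
  by rewrite Dl Zl Zr addrC.
have [p pP] := choice exp; have [q qP] := choice exq.
by exists n, v, w, p, q; split.
Qed.

Lemma mul_linear_bilin (K : fieldType) (A : algType K) (U V : lmodType K)
    (f : {linear U -> A}) (g : {linear V -> A}) :
  bilin (fun x y => f x * g y).
Proof. exact: bilin_comp (mul_bilin A). Qed.

Lemma functional_separation (K : fieldType) (U : lmodType K) (x y : U) :
  (forall f : {linear U -> K^o}, f x = f y) -> x = y.
Proof.
move=> fxy; apply: contrapT => /eqP; rewrite -subr_eq0 => /eqP xy.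
have [||f _ /eqP] := @exists_functional _ _ [set 0] (x - y) _ _ xy => //=.
  by move=> a _ _ -> ->; rewrite scaler0 addr0.
by rewrite linearB fxy subrr eq_sym oner_eq0.
Qed.

(** Write the difference of the two tensors with dual bases: the functionals dual
    to the first vectors on either side would give it the value 1. *)
Lemma tensor_separation (K : fieldType) (U V : lmodType K) (s t : tensor U V) :
  (forall (f : {linear U -> K^o}) (g : {linear V -> K^o}),
    tsum (fun x y => f x * g y : K^o) s = tsum (fun x y => f x * g y : K^o) t) ->
  s = t.
Proof.
move=> fst; apply/eqP; rewrite -subr_eq0; apply/eqP.
have [n [v [w [p [q [tE pv qw]]]]]] := tensor_dual_basis (s - t).
rewrite tE; case: n v w p q tE pv qw => [|n] v w p q tE pv qw.
  by rewrite big_ord0.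
have bpq := mul_linear_bilin (p ord0) (q ord0).
have := fst (p ord0) (q ord0).
move/eqP; rewrite -subr_eq0 -[_ - _](linearB (lin_of (tsum_linear bpq))) /= tE.
rewrite tsum_pure // big_ord_recl pv qw eqxx mulr1 big1 ?addr0 ?oner_eq0 // => i _.
by rewrite pv mul0r.
Qed.

(** * Convolution and comultiplicative matrices *)

Lemma conv_subproof (K : fieldType) (C : coalgType K) (A : algType K)
    (f g : {linear C -> A}) :
  linear (fun c => tsum (fun x y => f x * g y) (comul c)).
Proof.
by move=> a c d; rewrite linearP (tsum_linear (mul_linear_bilin f g)).
Qed.

Definition conv (K : fieldType) (C : coalgType K) (A : algType K)
    (f g : {linear C -> A}) : {linear C -> A} := lin_of (conv_subproof f g).

Lemma eq_conv (K : fieldType) (C : coalgType K) (A : algType K)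
    (f f' g g' : {linear C -> A}) : f =1 f' -> g =1 g' -> conv f g =1 conv f' g'.
Proof. by move=> ff gg c; apply: eq_tsum => x y; rewrite ff gg. Qed.

(** Apply the map of C (x) (C (x) C) to [A] induced by [f], [g] and [k] to the
    coassociativity axiom. *)
Lemma convA (K : fieldType) (C : coalgType K) (A : algType K)
    (f g k : {linear C -> A}) c :
  conv (conv f g) k c = conv f (conv g k) c.
Proof.
pose L2 : {linear tensor C C -> A} := lin_of (tsum_linear (mul_linear_bilin g k)).
pose L : {linear tensor C (tensor C C) -> A} :=
  lin_of (tsum_linear (mul_linear_bilin f L2)).
have Lt x z : L (x \ox z) = f x * L2 z.
  exact: (tsum_tens (mul_linear_bilin f L2)).
have L2t x y : L2 (x \ox y) = g x * k y.
  exact: (tsum_tens (mul_linear_bilin g k)).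
have := congr1 L (comulA c); rewrite !(raddf_tsum L) => LL.
transitivity (\tsum_(x, y <- comul c)
    L (\tsum_(x1, x2 <- comul x) x1 \ox (x2 \ox y))).
  apply: eq_tsum => x y; rewrite (raddf_tsum L) /= /tsum mulr_suml.
  by apply: eq_bigr => p _; rewrite [RHS]Lt L2t mulrA.
by rewrite LL; apply: eq_tsum => x y; rewrite [LHS]Lt.
Qed.

Lemma conv_counitl (K : fieldType) (C : coalgType K) (f : {linear C -> K^o}) c :
  conv (counit : {linear C -> K^o}) f c = f c.
Proof.
rewrite -[in RHS](counitl c) (raddf_tsum f); apply: eq_tsum => x y.
by rewrite [RHS]linearZ_LR.
Qed.

Lemma conv_counitr (K : fieldType) (C : coalgType K) (f : {linear C -> K^o}) c :
  conv f (counit : {linear C -> K^o}) c = f c.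
Proof.
rewrite -[in RHS](counitr c) (raddf_tsum f); apply: eq_tsum => x y.
by rewrite [RHS]linearZ_LR mulrC.
Qed.

(** The coefficient matrix of an [n]-dimensional comodule. *)
Definition comultiplicative (K : fieldType) (C : coalgType K) n (c : 'M[C]_n) :=
  (forall i j, comul (c i j) = \sum_k c i k \ox c k j) /\
  (forall i j, counit (c i j) = (i == j)%:R).

Definition ev (K : fieldType) (C : coalgType K) (f : {linear C -> K^o}) m n
  (c : 'M[C]_(m, n)) : 'M[K]_(m, n) := map_mx f c.

(** Row vectors form a module over the algebra of functionals: this reduces
    questions on comodules to scalar matrices. *)
Lemma comultiplicativeP (K : fieldType) (C : coalgType K) n (c : 'M[C]_n) :
  comultiplicative c <->
  (forall f g : {linear C -> K^o}, ev (conv f g) c = ev f c *m ev g c) /\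
  ev (counit : {linear C -> K^o}) c = 1%:M.
Proof.
split=> [] [cM c1]; [split=> [f g|]|split=> i j].
- apply/matrixP => i j; rewrite !mxE /= cM tsum_pure; last exact: mul_linear_bilin.
  by apply: eq_bigr => k _; rewrite !mxE.
- by apply/matrixP => i j; rewrite !mxE /= c1.
- apply: tensor_separation => f g; rewrite tsum_pure; last exact: mul_linear_bilin.
  have /matrixP/(_ i j) := cM f g; rewrite !mxE /= => ->.
  by apply: eq_bigr => k _; rewrite !mxE.
- by have /matrixP/(_ i j) := c1; rewrite !mxE.
Qed.

(** Write comul h = sum_i v_i \ox w_i with functionals p_i, q_i dual to v_i, w_i.
    The v_i span a comodule containing [h]; its coefficient c_ij is the part of
    comul v_j along v_i, characterized by f (c_ij) = (p_i * f * q_j) (h) for all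
    functionals [f].  All required identities follow from this formula, since
    (f * g) (h) = sum_i f (v_i) g (w_i) and q_i, p_i recover the factors:
    f (v_i) = (f * q_i) (h) and f (w_i) = (p_i * f) (h). *)
Lemma in_comultiplicative_span (K : fieldType) (C : coalgType K) (h : C) :
  exists n (c : 'M[C]_n) (a : 'M[K]_n),
    comultiplicative c /\ h = \sum_i \sum_j a i j *: c i j.
Proof.
have [n [v [w [p [q [hE pv qw]]]]]] := tensor_dual_basis (comul h).
have convE (f g : {linear C -> K^o}) : conv f g h = \sum_i f (v i) * g (w i).
  by rewrite /= hE tsum_pure //; exact: mul_linear_bilin.
have convl (f : {linear C -> K^o}) i : f (w i) = conv (p i) f h.
  rewrite convE (bigD1 i) //= pv eqxx mul1r big1 ?addr0 // => j.
  by rewrite pv eq_sym => /negPf ->; rewrite mul0r.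
have convr (f : {linear C -> K^o}) i : f (v i) = conv f (q i) h.
  rewrite convE (bigD1 i) //= qw eqxx mulr1 big1 ?addr0 // => j.
  by rewrite qw eq_sym => /negPf ->; rewrite mulr0.
have [c evc] : exists c : 'M[C]_n, forall (f : {linear C -> K^o}) i j,
    f (c i j) = conv (conv (p i) f) (q j) h.
  exists (\matrix_(i, j) \tsum_(x, y <- comul (v j)) p i x *: y) => f i j.
  rewrite -convr mxE (raddf_tsum f); apply: eq_tsum => x y; exact: linearZ_LR.
exists n, c, (\matrix_(i, j) (counit (v i) * counit (w j))); split.
  apply/comultiplicativeP; split=> [f g|]; apply/matrixP => i j; rewrite [LHS]mxE evc ?mxE.
    have -> : conv (conv (p i) (conv f g)) (q j) h
            = conv (conv (p i) f) (conv g (q j)) h.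
      by rewrite -convA; apply: eq_conv => // x; rewrite convA.
    by rewrite convE; apply: eq_bigr => k _; rewrite !mxE !evc -convr convA -convl.
  rewrite (eq_conv (conv_counitr (p i)) (frefl (q j))) convE (bigD1 i) //=.
  rewrite pv qw eqxx mul1r eq_sym big1 ?addr0 // => k.
  by rewrite pv eq_sym => /negPf ->; rewrite mul0r.
apply: functional_separation => f; rewrite linear_sum -[LHS]conv_counitl.
rewrite -(eq_conv (frefl (counit : {linear C -> K^o})) (conv_counitr f)) convE.
apply: eq_bigr => i _; rewrite convl -convA convE linear_sum mulr_sumr.
by apply: eq_bigr => j _; rewrite mxE linearZ_LR evc -convr mulrA; exact: mulrAC.
Qed.

(** * Simple comodules span simple subcoalgebras *)

(** The matrix product [U c V], written out because entries of [c] cannot be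
    multiplied. *)
Definition sandwich (K : fieldType) (C : coalgType K) m n p
    (U : 'M[K]_(m, n)) (c : 'M[C]_n) (V : 'M[K]_(n, p)) : 'M[C]_(m, p) :=
  \matrix_(i, j) \sum_k \sum_l (U i k * V l j) *: c k l.

Lemma map_sandwich (K : fieldType) (C : coalgType K) (A : algType K)
    (f : {linear C -> A}) m n p (U : 'M[K]_(m, n)) (c : 'M[C]_n) (V : 'M[K]_(n, p)) :
  map_mx f (sandwich U c V)
  = map_mx (in_alg A) U *m map_mx f c *m map_mx (in_alg A) V.
Proof.
apply/matrixP => i j; rewrite !mxE linear_sum.
rewrite (eq_bigr (fun k => \sum_l (U i k * V l j) *: f (c k l))) => [|k _]; last first.
  by rewrite linear_sum; apply: eq_bigr => l _; exact: linearZ.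
rewrite exchange_big; apply: eq_bigr => l _; rewrite !mxE mulr_suml.
apply: eq_bigr => k _; rewrite !mxE /= -scalerAl mul1r -scalerAl -scalerAr mulr1.
by rewrite scalerA.
Qed.

Lemma ev_sandwich (K : fieldType) (C : coalgType K) (f : {linear C -> K^o}) m n p
    (U : 'M[K]_(m, n)) (c : 'M[C]_n) (V : 'M[K]_(n, p)) :
  ev f (sandwich U c V) = U *m ev f c *m V.
Proof.
rewrite /ev map_sandwich; congr (_ *m _ *m _);
  by apply/matrixP => i j; rewrite mxE /=; exact: mulr1.
Qed.

(** A subcomodule, seen as a subspace of row vectors. *)
Definition stable_subspace (K : fieldType) (C : coalgType K) n (c : 'M[C]_n)
    (T : set 'rV[K]_n) :=
  [/\ T 0, forall (a : K) x y, T x -> T y -> T (a *: x + y)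
    & forall (f : {linear C -> K^o}) x, T x -> T (x *m ev f c)].

Definition irreducible_mx (K : fieldType) (C : coalgType K) n (c : 'M[C]_n) :=
  forall T, stable_subspace c T -> (forall x, T x -> x = 0) \/ (forall x, T x).

Definition entry_span (K : fieldType) (C : coalgType K) n (c : 'M[C]_n) : set C :=
  [set x | exists a : 'M[K]_n, x = \sum_i \sum_j a i j *: c i j].

Lemma entry_span_mem (K : fieldType) (C : coalgType K) n (c : 'M[C]_n) i j :
  entry_span c (c i j).
Proof.
exists (delta_mx i j); rewrite (bigD1 i) //= (bigD1 j) //= mxE !eqxx scale1r.
rewrite big1 => [|k kj]; last by rewrite mxE eqxx (negPf kj) scale0r.
rewrite addr0 big1 ?addr0 // => k ki; rewrite big1 // => l _.
by rewrite mxE (negPf ki) scale0r.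
Qed.

Lemma entry_span_min (K : fieldType) (C : coalgType K) n (c : 'M[C]_n) (E : set C) :
  subspace E -> (forall i j, E (c i j)) -> entry_span c `<=` E.
Proof.
move=> [E0 EL] Ec _ [a ->].
have ED x y : E x -> E y -> E (x + y) by rewrite -{2}[x]scale1r; exact: EL.
apply: big_ind => // i _; apply: big_ind => // j _.
by rewrite -[_ *: _]addr0; exact: EL.
Qed.

Lemma entry_span_subspace (K : fieldType) (C : coalgType K) n (c : 'M[C]_n) :
  subspace (entry_span c).
Proof.
split.
  by exists 0; rewrite big1 // => i _; rewrite big1 // => j _; rewrite mxE scale0r.
move=> a _ _ [b ->] [d ->]; exists (a *: b + d).
rewrite scaler_sumr -big_split; apply: eq_bigr => i _ /=.
rewrite scaler_sumr -big_split; apply: eq_bigr => j _ /=.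
by rewrite !mxE scalerDl scalerA.
Qed.

Lemma entry_span_subcoalgebra (K : fieldType) (C : coalgType K) n (c : 'M[C]_n) :
  comultiplicative c -> subcoalgebra (entry_span c).
Proof.
move=> [cM _]; split; first exact: entry_span_subspace.
move=> _ [a ->].
exists [seq (a p.1 p.2.1 *: c p.1 p.2.2, c p.2.2 p.2.1)
         | p <- enum {: 'I_n * ('I_n * 'I_n)}].
split.
  move=> _ /mapP[p _ ->] /=; split; last exact: entry_span_mem.
  have [D0 DL] := entry_span_subspace c.
  by rewrite -[_ *: _]addr0; apply: DL => //; exact: entry_span_mem.
have [tDl _] := @tens_bilin K C C.
have Zl b (u : C) (x : C) : (b *: u) \ox x = b *: (u \ox x).
  exact: (linearZ_LR (lin_of (tDl x))).
rewrite big_map big_enum /= linear_sum.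
rewrite -(pair_bigA _ (fun i p => (a i p.1 *: c i p.2) \ox c p.2 p.1)) /=.
apply: eq_bigr => i _; rewrite linear_sum.
rewrite -(pair_bigA _ (fun j k => (a i j *: c i k) \ox c k j)) /=.
apply: eq_bigr => j _; rewrite linearZ /= cM scaler_sumr.
by apply: eq_bigr => k _; rewrite Zl.
Qed.

(** With the functionals as an algebra under convolution, this is the fact that an
    algebra with a faithful simple module of finite dimension is simple.  The
    functionals [I] vanishing on [E] form a two-sided ideal, which is nonzero on [c]
    because [E] is proper.  One shows by descending induction on [r] that every [f]
    for which the first [r] rows of [ev f c] vanish is in [I]; for [r = 0] this says
    that [I] contains all functionals, so that [E = 0].  In the inductive step let
    [R] be the right ideal of the functionals with vanishing first [r] rows.  The
    values of the next row on [R] form a stable subspace, as do its values on the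
    part of [R] in [I].  If the latter is everything, [f] can be corrected by an
    element of [I] so that one more row vanishes.  If it is zero, the former cannot
    be everything, because convolving with an element of [I] would show that [I]
    vanishes on [c]; so it is zero too, and [f] already has one more zero row. *)
Lemma irreducible_subcoalgebra (K : fieldType) (C : coalgType K) n (c : 'M[C]_n)
    (E : set C) :
  comultiplicative c -> irreducible_mx c ->
  subcoalgebra E -> E `<=` entry_span c -> E <> entry_span c -> E = [set 0].
Proof.
move=> cM cI [[E0 EL] Ecomul] ED nED.
have [evM _] := (comultiplicativeP c).1 cM.
pose I (f : {linear C -> K^o}) := forall e, E e -> f e = 0.
have convI f g : I f \/ I g -> I (conv f g).
  move=> fgI e /Ecomul[s [sE eE]] /=; rewrite eE tsum_sum; last exact: mul_linear_bilin.
  rewrite big_seq big1 // => p /sE[p1 p2]; rewrite tsum_tens; last exact: mul_linear_bilin.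
  by case: fgI => fI; rewrite fI // (mul0r, mulr0).
(* [I] is nonzero on [c], as [E] misses some entry of [c]. *)
have [f0 f0I f0c] : exists2 f0, I f0 & ev f0 c != 0.
  apply: contrapT => nof; apply: nED; rewrite eqEsubset; split=> //.
  apply: entry_span_min => // i j; apply: contrapT => Ecij; apply: nof.
  have [f fE fc] := exists_functional E0 EL Ecij.
  exists f => //; apply/negP => /eqP/matrixP/(_ i j)/eqP.
  by rewrite !mxE fc oner_eq0.
pose low r (f : {linear C -> K^o}) := forall i : 'I_n, (i < r)%N -> row i (ev f c) = 0.
have evD a (f g : {linear C -> K^o}) : ev (a \*: f \+ g) c = a *: ev f c + ev g c.
  by apply/matrixP => i j; rewrite !mxE.
have rowD a (f g : {linear C -> K^o}) i :
    row i (ev (a \*: f \+ g) c) = a *: row i (ev f c) + row i (ev g c).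
  by rewrite evD linearP.
have rowM (f g : {linear C -> K^o}) i :
    row i (ev (conv f g) c) = row i (ev f c) *m ev g c.
  by rewrite evM row_mul.
have ID a (f g : {linear C -> K^o}) : I f -> I g -> I (a \*: f \+ g).
  by move=> fI gI e Ee /=; rewrite fI // gI // scaler0 addr0.
have lowD r a (f g : {linear C -> K^o}) : low r f -> low r g -> low r (a \*: f \+ g).
  by move=> fl gl i ir; rewrite rowD fl // gl // scaler0 addr0.
have lowM r f g : low r f -> low r (conv f g).
  by move=> fl i ir; rewrite rowM fl // mul0mx.
have low0 r : low r (\0 : {linear C -> K^o}).
  by move=> i _; apply/rowP => j; rewrite !mxE.
have stableT (J : {linear C -> K^o} -> Prop) i : J \0 ->
    (forall a (f g : {linear C -> K^o}), J f -> J g -> J (a \*: f \+ g)) ->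
    (forall f g, J f -> J (conv f g)) ->
    stable_subspace c [set row i (ev g c) | g in J].
  move=> J0 JD JM; split.
  - by exists \0 => //; apply/rowP => j; rewrite !mxE.
  - by move=> a _ _ [f Jf <-] [g Jg <-]; exists (a \*: f \+ g); [exact: JD|rewrite rowD].
  - by move=> f _ [g Jg <-]; exists (conv g f); [exact: JM|rewrite rowM].
have main j : (j <= n)%N -> forall f, low (n - j)%N f -> I f.
  elim: j => [_ f fl e /ED [a ->]|j IHj jn f fl].
    rewrite linear_sum big1 // => i _; rewrite linear_sum big1 // => k _.
    have i_lt : (i < n - 0)%N by rewrite subn0.
    have := congr1 (fun x : 'rV_n => x 0 k) (fl i i_lt); rewrite !mxE => fik.
    by rewrite [LHS]linearZ_LR fik scaler0.
  have rn : (n - j.+1 < n)%N by rewrite subnSK // leq_subr.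
  pose r := Ordinal rn.
  have lowS g : low (n - j.+1)%N g -> row r (ev g c) = 0 -> low (n - j)%N g.
    move=> gl gr i; rewrite -subnSK // ltnS leq_eqVlt => /orP[/eqP ir|]; last exact: gl.
    by rewrite (_ : i = r) //; exact: val_inj.
  have [||||T2] := cI _ (stableT (fun g => I g /\ low (n - j.+1)%N g) r _ _ _).
  - by split; [move=> e|exact: low0].
  - by move=> a g h [? ?] [? ?]; split; [exact: ID|exact: lowD].
  - by move=> g h [? ?]; split; [apply: convI; left|exact: lowM].
  - move=> T2.
    have [||||T1] := cI _ (stableT (low (n - j.+1)%N) r _ _ _).
    + exact: low0.
    + exact: lowD.
    + exact: lowM.
    + by move=> T1; apply: IHj (ltnW jn) _ _; apply: lowS => //; apply: T1; exists f.
    + (* Some [g] with vanishing first rows takes the unit vector [e_i] as its next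
         row, so the next row of [conv g f0] is the [i]-th row of [f0]. *)
      case/eqP: f0c; apply/row_matrixP => i; rewrite row0 rowE; apply: T2.
      have [g gl gi] := T1 (delta_mx 0 i).
      exists (conv g f0); last by rewrite rowM gi.
      by split; [apply: convI; right|exact: lowM].
  - (* [f - g] has one more vanishing row than [f], and [g] is in [I]. *)
    have [g [gI gl] gr] := T2 (row r (ev f c)).
    have : I (-1 \*: g \+ f).
      apply: IHj (ltnW jn) _ _; apply: lowS; first exact: lowD.
      by rewrite rowD gr scaleN1r addNr.
    by move=> fgI e Ee; have := fgI e Ee; rewrite /= (gI e Ee) scaler0 add0r.
rewrite eqEsubset; split=> [e Ee|_ ->//].
apply: functional_separation => f; rewrite linear0.
by apply: (main n (leqnn n) f) => // i; rewrite subnn.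
Qed.

(** * Convolution idempotents on a pointed coalgebra *)

(** Take [U] of greatest rank among the matrices whose row space is inside [T]. *)
Lemma row_space_of_pred (K : fieldType) n (T : set 'rV[K]_n) :
  T 0 -> (forall (a : K) x y, T x -> T y -> T (a *: x + y)) ->
  exists U : 'M[K]_n, forall x, T x <-> (x <= U)%MS.
Proof.
move=> T0 TL.
pose P r := `[< exists U : 'M[K]_n, (forall x, (x <= U)%MS -> T x) /\ \rank U = r >].
have exP : exists r, P r.
  exists 0; apply/asboolP; exists 0; split=> [x|]; last exact: mxrank0.
  by rewrite submx0 => /eqP ->.
have Pn r : P r -> (r <= n)%N by move=> /asboolP[U [_ <-]]; exact: rank_leq_row.
have [_ /asboolP[U [UT <-]] Umax] := ex_maxnP exP Pn.
exists U => x; split=> [Tx|]; last exact: UT.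
have /Umax UxU : P (\rank (U + x)%MS).
  apply/asboolP; exists (U + x)%MS; split=> // y /sub_addsmxP[[u v] ->] /=.
  rewrite addrC [v]mx11_scalar mul_scalar_mx; apply: TL => //.
  by apply: UT; exact: submxMl.
have /eqmxP : (U == U + x)%MS by rewrite -(geq_leqif (mxrank_leqif_eq (addsmxSl U x))).
by move=> ->; exact: addsmxSr.
Qed.

(** The rows of [B] and [V] form a basis of the whole space adapted to the row space
    of [U], and [P], [Q] are the two blocks of columns of the inverse matrix. *)
Lemma complement_split (K : fieldType) n (U : 'M[K]_n) :
  exists (B : 'M[K]_(\rank U, n)) (V : 'M[K]_(n - \rank U, n))
    (P : 'M[K]_(n, \rank U)) (Q : 'M[K]_(n, n - \rank U)),
  (B :=: U)%MS /\
  [/\ B *m P = 1%:M, V *m Q = 1%:M, B *m Q = 0 & P *m B + Q *m V = 1%:M].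
Proof.
pose V := castmx (mxrank_compl U, erefl n) (row_base (U^C)%MS).
have VE : (V :=: U^C)%MS by apply: eqmx_trans (eqmx_cast _ _) (eq_row_base _).
pose M := col_mx (row_base U) V.
have ME : (M :=: U + U^C)%MS.
  apply: eqmx_trans (eqmx_sym (addsmxE _ _)) _.
  by apply: adds_eqmx => //; exact: eq_row_base.
have Mfull : row_full M by rewrite -col_leq_rank ME col_leq_rank; exact: addsmx_compl_full.
have Mfree : row_free M.
  rewrite /row_free (eqP Mfull); rewrite subnKC //; exact: rank_leq_col.
have := mulmxVp Mfree; have := mulVpmx Mfull.
rewrite -[pinvmx M]hsubmxK; set P := lsubmx _; set Q := rsubmx _.
rewrite mul_row_col mul_col_row scalar_mx_block => PQ /eq_block_mx[BP BQ _ VQ].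
by exists (row_base U), V, P, Q; split=> //; exact: eq_row_base.
Qed.

(** Both the matrix of a subcomodule and that of the quotient comodule are of this
    form, and in both cases the last hypothesis expresses stability. *)
Lemma comultiplicative_sandwich (K : fieldType) (C : coalgType K) m n
    (c : 'M[C]_n) (U : 'M[K]_(m, n)) (V : 'M[K]_(n, m)) :
  comultiplicative c -> U *m V = 1%:M ->
  (forall f g : {linear C -> K^o},
     U *m ev f c *m ev g c *m V = U *m ev f c *m V *m (U *m ev g c *m V)) ->
  comultiplicative (sandwich U c V).
Proof.
move=> /comultiplicativeP[cM c1] UV UcV; apply/comultiplicativeP.
split=> [f g|]; first by rewrite !ev_sandwich cM -UcV !mulmxA.
by rewrite ev_sandwich c1 mulmx1.
Qed.

(** The entries span a simple subcoalgebra, hence a line; the counit axiom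
    determines every entry as a multiple of the first one, which is then
    grouplike. *)
Lemma irreducible_pointed (K : fieldType) (C : coalgType K) n (c : 'M[C]_n) :
  (0 < n)%N -> pointed C -> comultiplicative c -> irreducible_mx c ->
  exists2 g, grouplike g & forall i j, c i j = (i == j)%:R *: g.
Proof.
case: n c => // n c _ Cpt cM cI; have [comul_c counit_c] := cM.
have ED := entry_span_subcoalgebra cM.
have c00 : counit (c ord0 ord0) = 1 :> K by rewrite counit_c eqxx.
have [|v [_ Dv]] := Cpt (entry_span c).
  split=> // [D0|E Esub ED'].
    have := entry_span_mem c ord0 ord0; rewrite D0 => /= c0.
    by move/eqP: c00; rewrite c0 linear0 eq_sym oner_eq0.
  have [->|nE] := pselect (E = entry_span c); first by right.
  by left; exact: irreducible_subcoalgebra nE.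
have exm i j : exists m : K, c i j = m *: v.
  by have := entry_span_mem c i j; rewrite Dv => -[m _ <-]; exists m.
have cE i j : c i j = (i == j)%:R *: c ord0 ord0.
  have [a cij] := exm i j; have [b c0] := exm ord0 ord0.
  have bv : b * counit v = 1 by rewrite -c00 c0 [RHS]linearZ_LR.
  have <- : a * counit v = (i == j)%:R by rewrite -counit_c cij [RHS]linearZ_LR.
  by rewrite cij c0 scalerA -mulrA (mulrC _ b) bv mulr1.
exists (c ord0 ord0) => //; split.
  by move=> c0; move/eqP: c00; rewrite c0 linear0 eq_sym oner_eq0.
rewrite comul_c (bigD1 ord0) //= big1 ?addr0 // => k k0.
have [tDl _] := @tens_bilin K C C.
by rewrite cE eq_sym (negPf k0) scale0r; exact: (linear0 (lin_of (tDl _))).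
Qed.

(** Evaluate [d] on a comultiplicative matrix [c], which gives an idempotent matrix
    [X], and argue by induction on the size of [c].  If [c] is irreducible, [X] is
    [d g] times the identity with [g] grouplike.  When there is a stable subspace, the
    diagonal blocks of [X] vanish by induction and the block [B X Q] vanishes by
    stability; in an adapted basis at most one block of [X] is nonzero, off the diagonal,
    and [X = X *m X = 0]. *)
Lemma conv_idempotent_eq0 (K : fieldType) (C : coalgType K) (A : algType K)
    (d : {linear C -> A}) :
  pointed C -> (forall c, conv d d c = d c) ->
  (forall g, grouplike g -> d g = 0) -> forall c, d c = 0.
Proof.
move=> Cpt dd dg h; have [n [c [a [cM ->]]]] := in_comultiplicative_span h.
suff dc : map_mx d c = 0.
  rewrite linear_sum big1 // => i _; rewrite linear_sum big1 // => j _.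
  by have /matrixP/(_ i j) := dc; rewrite linearZ !mxE /= => ->; rewrite scaler0.
move: {a} n c cM => n; have [m] := ubnP n; elim: m n => // m IHm n nm c cM.
rewrite ltnS in nm.
have XX : map_mx d c *m map_mx d c = map_mx d c.
  apply/matrixP => i j; rewrite !mxE -dd /= cM.1 tsum_pure; last exact: mul_linear_bilin.
  by apply: eq_bigr => k _; rewrite !mxE.
have [n0|n0] := posnP n.
  by move: c {cM XX nm}; rewrite n0 => c; apply/matrixP => -[].
have [cI|] := pselect (irreducible_mx c).
  apply/matrixP => i j; rewrite !mxE; have [g gG cg] := irreducible_pointed n0 Cpt cM cI.
  by rewrite cg linearZ /= dg // scaler0.
move=> /existsNP[T /not_implyP[[T0 TL TM] /not_orP[]]].
move=> /existsNP[x /not_implyP[Tx x0]] /existsNP[y Ty].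
have [U TU] := row_space_of_pred T0 TL.
have [B [V [P [Q [BU [BP VQ BQ PBQV]]]]]] := complement_split U.
(* [B] is a basis of the stable subspace and [Q] vanishes on it. *)
have BcQ0 f : B *m ev f c *m Q = 0.
  have /submxP[D ->] : (B *m ev f c <= B)%MS.
    rewrite BU; apply/row_subP => i; rewrite row_mul.
    apply/TU/TM/TU; apply: submx_trans (row_sub i B) _.
    by rewrite BU.
  by rewrite -mulmxA BQ mulmx0.
(* Functionals separate points, so this block is zero over [C], hence also after
   applying [d]. *)
have BcQ : sandwich B c Q = 0.
  apply/matrixP => i j; apply: functional_separation => f.
  have /matrixP/(_ i j) := BcQ0 f; rewrite -ev_sandwich [LHS]mxE => ->.
  by rewrite !mxE linear0.
have r0 : (0 < \rank U)%N.
  rewrite lt0n mxrank_eq0; apply/eqP => U0; apply: x0.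
  by move/TU: Tx; rewrite U0 submx0 => /eqP.
have rn : (\rank U < n)%N.
  rewrite ltn_neqAle rank_leq_row andbT; apply/negP => Ufull; apply: Ty.
  by apply/TU; apply: submx_full; rewrite /row_full.
have c1M : comultiplicative (sandwich B c P).
  apply: comultiplicative_sandwich => // f g.
  rewrite -[in LHS](mulmx1 (B *m ev f c)) -PBQV mulmxDr 2!mulmxA BcQ0 mul0mx addr0.
  by rewrite !mulmxA.
have c2M : comultiplicative (sandwich V c Q).
  apply: comultiplicative_sandwich => // f g.
  rewrite -[in LHS](mulmx1 (V *m ev f c)) -PBQV mulmxDr !mulmxDl.
  by rewrite -!mulmxA [B *m _]mulmxA BcQ0 !mulmx0 add0r !mulmxA.
have := IHm _ _ _ c1M; have := IHm _ _ _ c2M.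
have := congr1 (map_mx d) BcQ; rewrite !map_sandwich map_mx0.
have := congr1 (map_mx (in_alg A)) PBQV; rewrite map_mxD !map_mxM map_mx1.
move: XX; set X := map_mx d c; set B' := map_mx _ B; set P' := map_mx _ P.
set V' := map_mx _ V; set Q' := map_mx _ Q => XX PQ BXQ VXQ BXP.
have {}BXP := BXP (leq_trans rn nm).
have {}VXQ : V' *m X *m Q' = 0.
  by apply: VXQ; apply: leq_trans nm; rewrite ltn_subrL r0.
have BX : B' *m X = 0.
  by rewrite -[LHS]mulmx1 -PQ mulmxDr !mulmxA BXP BXQ !mul0mx addr0.
have XQ : X *m Q' = 0.
  by rewrite -[LHS]mul1mx -PQ mulmxDl -!mulmxA [B' *m _]mulmxA BX [V' *m _]mulmxA VXQ
    mul0mx !mulmx0 addr0.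
rewrite -XX -[X in X *m _]mulmx1 -PQ mulmxDr mulmxDl !mulmxA XQ !mul0mx addr0.
by rewrite -!mulmxA BX !mulmx0.
Qed.

(** * Grouplike elements *)

Lemma scale_bilin (K : fieldType) (V : lmodType K) :
  bilin (fun (a : K^o) (v : V) => a *: v).
Proof.
split=> [v a b b'|b a v v']; first by rewrite scalerDl scalerA.
by rewrite scalerDr !scalerA mulrC.
Qed.

Section GrouplikeElements.
Variables (K : fieldType) (H : hopfType K).
Implicit Types g k : H.

Lemma right_mul_linear (k : H) : linear (fun h : H => h * k).
Proof. by move=> a x y; rewrite mulrDl scalerAl. Qed.

Definition right_mul k : {linear H -> H} := lin_of (right_mul_linear k).

Lemma mul_tens_bilin (x y : H) : bilin (fun h k : H => (h * x) \ox (k * y)).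
Proof. exact: (bilin_comp (right_mul x) (right_mul y) (tens_bilin H H)). Qed.

Lemma tens_mul_bilin (x y : H) : bilin (fun h k : H => (x * h) \ox (y * k)).
Proof.
have lin (z : H) : linear (fun h : H => z * h).
  by move=> a u v; rewrite mulrDr scalerAr.
exact: (bilin_comp (lin_of (lin x)) (lin_of (lin y)) (tens_bilin H H)).
Qed.

Lemma comul_mul_grouplike (h k : H) : comul k = k \ox k ->
  comul (h * k) = \tsum_(h1, h2 <- comul h) (h1 * k) \ox (h2 * k).
Proof.
move=> kG; rewrite comulM; apply: eq_tsum => x y.
by rewrite kG tsum_tens //; exact: tens_mul_bilin.
Qed.

Lemma grouplike_counit g : grouplike g -> counit g = 1 :> K.
Proof.
move=> [/eqP g0 gG]; have := counitl g; rewrite gG tsum_tens; last first.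
  exact: (bilin_comp (counit : {linear H -> K^o}) idfun (scale_bilin H)).
move/eqP; rewrite -subr_eq0 -{3}[g]scale1r -scalerBl scaler_eq0 (negPf g0) orbF.
by rewrite subr_eq0 => /eqP.
Qed.

Lemma grouplike1 : grouplike (1 : H).
Proof. by split; [apply/eqP; exact: oner_neq0|exact: comul1]. Qed.

Lemma grouplikeM g k : grouplike g -> grouplike k -> grouplike (g * k).
Proof.
move=> gG kG; split.
  move=> gk0; have := counitM g k; rewrite gk0 linear0 !grouplike_counit // mulr1.
  by move/eqP; rewrite eq_sym oner_eq0.
rewrite comul_mul_grouplike ?kG.2 // gG.2 tsum_tens //; exact: mul_tens_bilin.
Qed.

(** The inverse is the antipode [g'] of [g].  It is grouplike because multiplying both
    factors of [comul g'] by [g] on the right gives [comul (g' * g) = 1 \ox 1], and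
    multiplying them by [g'] undoes this. *)
Lemma grouplikeV g : grouplike g ->
  exists2 g', grouplike g' & g * g' = 1 /\ g' * g = 1.
Proof.
move=> gG; have lin_id : bilin (fun h k : H => h * k) := mul_bilin H.
have g'g : antipode g * g = 1.
  have := antipodel g; rewrite gG.2 tsum_tens ?grouplike_counit ?scale1r //.
  exact: (bilin_comp antipode idfun lin_id).
have gg' : g * antipode g = 1.
  have := antipoder g; rewrite gG.2 tsum_tens ?grouplike_counit ?scale1r //.
  exact: (bilin_comp idfun antipode lin_id).
exists (antipode g) => //; set g' := antipode g in g'g gg' *; split.
  by move=> g'0; move/eqP: g'g; rewrite g'0 mul0r eq_sym oner_eq0.
pose L : {linear tensor H H -> tensor H H} :=
  lin_of (tsum_linear (mul_tens_bilin g' g')).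
have Lt x y : L (x \ox y) = (x * g') \ox (y * g').
  exact: (tsum_tens (mul_tens_bilin g' g')).
have := congr1 L (comul_mul_grouplike g' gG.2).
rewrite g'g comul1 Lt !mul1r (raddf_tsum L) => ->.
rewrite [LHS]tensor_repr; apply: eq_tsum => x y.
by rewrite [RHS]Lt -!mulrA gg' !mulr1.
Qed.

End GrouplikeElements.

(** * Central idempotents *)

Section CentralIdempotents.
Variable R : pzRingType.
Implicit Types e p : R.

Definition central e := forall a, e * a = a * e.

Lemma central_prod (T : eqType) (s : seq T) (F : T -> R) :
  (forall x, x \in s -> central (F x)) -> central (\prod_(x <- s) F x).
Proof.
move=> Fc a; rewrite big_seq; elim/big_rec: _ => [|x y xs IH]; first by rewrite mul1r mulr1.
by rewrite -mulrA IH mulrA Fc // mulrA.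
Qed.

Lemma central1B e : central e -> central (1 - e).
Proof. by move=> ec a; rewrite mulrBl mulrBr mul1r mulr1 ec. Qed.

Lemma centralM e e' : central e -> central e' -> central (e * e').
Proof. by move=> ec ec' a; rewrite -mulrA ec' !mulrA ec. Qed.

Lemma prod_absorb (T : eqType) (s : seq T) (F : T -> R) x :
  (forall y, y \in s -> central (F y)) -> F x * F x = F x -> x \in s ->
  (\prod_(y <- s) F y) * F x = \prod_(y <- s) F y.
Proof.
move=> Fc Fx; elim: s Fc => // y s IHs Fc; rewrite inE big_cons => /orP[/eqP xy|xs].
  have Fxc : central (F x) by apply: Fc; rewrite inE xy eqxx.
  by rewrite -xy -mulrA -(Fxc (\prod_(j <- s) F j)) mulrA Fx.
by rewrite -mulrA IHs // => z zs; apply: Fc; rewrite inE zs orbT.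
Qed.

Lemma absorb_prod (T : eqType) (s : seq T) (F : T -> R) p :
  (forall x, x \in s -> p * F x = p) -> p * (\prod_(x <- s) F x) = p.
Proof.
move=> pF; rewrite big_seq; elim/big_rec: _ => [|x y xs IH]; first by rewrite mulr1.
by rewrite mulrA pF.
Qed.

End CentralIdempotents.

(** * Symmetric partial actions *)

Section PartialAction.
Variables (K : fieldType) (H : hopfType K) (A : algType K).
Variable act : {linear tensor H A -> A}.
Hypothesis Hact : symmetric_partial_action act.
Implicit Types (h k g : H) (a b e f : A).

Local Notation "h \dot a" := (act (h \ox a)) (at level 40, left associativity).

Lemma act_bilin : bilin (fun h a => h \dot a).
Proof.
have [tl tr] := @tens_bilin K H A.
by split=> [a c h h'|h c a b]; rewrite (tl, tr) linearP.
Qed.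

Definition actl a : {linear H -> A} := lin_of (act_bilin.1 a).

Definition actr h : {linear A -> A} := lin_of (act_bilin.2 h).

Lemma act1 a : 1 \dot a = a.
Proof. by case: Hact. Qed.

Lemma actM h a b : h \dot (a * b) = conv (actl a) (actl b) h.
Proof. by case: Hact. Qed.

Lemma act_grouplikeM g a b : grouplike g ->
  g \dot (a * b) = (g \dot a) * (g \dot b).
Proof.
move=> [_ gG]; rewrite actM /= gG tsum_tens //.
exact: (mul_linear_bilin (actl a) (actl b)).
Qed.

Lemma act_grouplike_act g k a : grouplike g ->
  g \dot (k \dot a) = (g \dot 1) * ((g * k) \dot a).
Proof.
have [_ _ act2 _] := Hact; move=> [_ gG]; rewrite act2 gG tsum_tens //.
exact: (mul_linear_bilin (actl 1) (actl a \o right_mul k)).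
Qed.

Lemma act_grouplike_act' g k a : grouplike g ->
  g \dot (k \dot a) = ((g * k) \dot a) * (g \dot 1).
Proof.
have [_ _ _ act3] := Hact; move=> [_ gG]; rewrite act3 gG tsum_tens //.
exact: (mul_linear_bilin (actl a \o right_mul k) (actl 1)).
Qed.

Lemma act_grouplike_idem g : grouplike g -> (g \dot 1) * (g \dot 1) = g \dot 1.
Proof. by move=> gG; rewrite -act_grouplikeM // mulr1. Qed.

(** The two composition axioms, applied to [g] and its inverse, compute the same
    element as [(g \dot 1) * a] and as [a * (g \dot 1)]. *)
Lemma act_grouplike_central g : grouplike g -> central (g \dot 1).
Proof.
move=> gG a; have [g' _ [gg' _]] := grouplikeV gG.
have := act_grouplike_act g' a gG.
by rewrite act_grouplike_act' // gg' act1 => ->.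
Qed.

(** The map [h |-> (h \dot e) * f] is idempotent for convolution. *)
Lemma act_central_idempotent e f : pointed H ->
  e * e = e -> central f -> f * f = f ->
  (forall g, grouplike g -> (g \dot e) * f = 0) -> forall h, (h \dot e) * f = 0.
Proof.
move=> Hpt ee fc ff ge0.
have dlin : linear (fun h => (h \dot e) * f).
  by move=> c h h'; rewrite (act_bilin.1 e) mulrDl scalerAl.
apply: (conv_idempotent_eq0 (d := lin_of dlin)) => // h.
rewrite /= -{3}ee actM /= /tsum mulr_suml; apply: eq_bigr => p _.
by rewrite -mulrA [f * _]mulrA fc -!mulrA ff.
Qed.

Lemma act_complementary e f : pointed H ->
  central e -> e * e = e -> central f -> f * f = f -> e + f = 1 ->
  (forall g, grouplike g -> (g \dot e) * f = 0 /\ (g \dot f) * e = 0) ->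
  forall h, h \dot e = (h \dot 1) * e.
Proof.
move=> Hpt ec ee fc ff ef g0 h.
have hef : (h \dot e) * f = 0.
  by apply: act_central_idempotent => // g /g0[].
have hfe : (h \dot f) * e = 0.
  by apply: act_central_idempotent => // g /g0[].
have -> : h \dot 1 = h \dot e + h \dot f by rewrite -ef; exact: (linearD (actr h)).
by rewrite mulrDl hfe addr0 -[LHS]mulr1 -ef mulrDr hef addr0.
Qed.

Lemma act_mul_invariant e :
  (forall h, h \dot e = (h \dot 1) * e) ->
  forall h a, h \dot (a * e) = (h \dot a) * e.
Proof.
move=> he h a; rewrite actM -[in RHS](mulr1 a) actM /= /tsum mulr_suml.
by apply: eq_bigr => p _; rewrite he mulrA.
Qed.

Hypothesis Gfin : finite_set (@grouplike K H).

Lemma in_Gset g : g \in Gset H <-> grouplike g.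
Proof. by rewrite /Gset in_fset_set // in_setE. Qed.

Local Notation P := (Pidem act).
Local Notation G := (Gset H).

Lemma Pidem_central X : (X `<=` G)%fset -> central (P X).
Proof.
move=> /fsubsetP XG; apply: centralM; apply: central_prod => x.
  by move=> /XG/in_Gset; exact: act_grouplike_central.
by rewrite inE => /andP[_ /in_Gset yG]; apply/central1B/act_grouplike_central.
Qed.

Lemma Pidem_mem X x : (X `<=` G)%fset -> x \in X -> P X * (x \dot 1) = P X.
Proof.
move=> /fsubsetP XG xX; have xG := (in_Gset x).1 (XG x xX).
rewrite /Pidem -mulrA -(act_grouplike_central xG) mulrA; congr (_ * _).
apply: prod_absorb xX => [y /XG/in_Gset yG|]; first exact: act_grouplike_central.
exact: act_grouplike_idem.
Qed.

Lemma Pidem_notin X y : (X `<=` G)%fset -> y \in G -> y \notin X ->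
  P X * (y \dot 1) = 0.
Proof.
move=> XG yG yX; have /in_Gset gy := yG; have ey := act_grouplike_idem gy.
suff Py : P X * (1 - y \dot 1) = P X.
  by rewrite -[in LHS]Py -mulrA mulrBl mul1r ey subrr mulr0.
rewrite /Pidem -mulrA; congr (_ * _).
apply: (@prod_absorb _ _ _ (fun z => 1 - z \dot 1)) => [z||].
- by rewrite inE => /andP[_ /in_Gset zG]; apply/central1B/act_grouplike_central.
- by rewrite mulrBr mulr1 mulrBl mul1r ey subrr subr0.
- by rewrite inE yX.
Qed.

Lemma Pidem_idem X : (X `<=` G)%fset -> P X * P X = P X.
Proof.
move=> XG; rewrite {2}/Pidem mulrA [X in X * _]absorb_prod => [|x]; last exact: Pidem_mem.
apply: absorb_prod => y; rewrite inE => /andP[yX yG].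
by rewrite mulrBr mulr1 Pidem_notin // subr0.
Qed.

Lemma Pidem_notin1 X : (X `<=` G)%fset -> 1 \notin X -> P X = 0.
Proof.
move=> XG X1; rewrite -[P X]mulr1 -[1]act1 Pidem_notin //.
exact/in_Gset/grouplike1.
Qed.

Lemma Pidem_orthogonal X Y : (X `<=` G)%fset -> (Y `<=` G)%fset -> X != Y ->
  P X * P Y = 0.
Proof.
have key U V x : (U `<=` G)%fset -> (V `<=` G)%fset -> x \in U -> x \notin V ->
    P U * P V = 0.
  move=> UG VG xU xV; have xG := fsubsetP UG x xU.
  rewrite -(Pidem_mem UG xU) -mulrA act_grouplike_central; last exact/in_Gset.
  by rewrite Pidem_notin ?mulr0.
move=> XG YG; rewrite eqEfsubset negb_and => /orP[] /fsubsetPn[x x1 x2].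
  exact: key x1 x2.
by rewrite Pidem_central //; exact: key x1 x2.
Qed.

(** Since [act (g \ox _)] is multiplicative, [g \dot P X] absorbs [(g * x) \dot 1]
    when [x] is in [X], and kills it when [x] is in [G] but not in [X].  Comparing
    with [P Y], a nonzero product forces [z] in [Y] if and only if [g^-1 z] is in [X];
    for [z = 1] this says that [g^-1] is in [X]. *)
Lemma act_Pidem_neq0 g X Y : P1 X -> P1 Y -> grouplike g ->
  (g \dot P X) * P Y <> 0 -> trans_equiv X Y.
Proof.
move=> [XG X1] [YG Y1] gG nz.
have [g' g'G [gg' g'g]] := grouplikeV gG.
have gP1 : (g \dot P X) * (g \dot 1) = g \dot P X by rewrite -act_grouplikeM ?mulr1.
have gPe x : (g \dot P X) * ((g * x) \dot 1) = g \dot (P X * (x \dot 1)).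
  by rewrite act_grouplikeM // act_grouplike_act // mulrA gP1.
have XY z : grouplike z -> (z \in Y) = (g' * z \in X).
  move=> zG; have g'zG := grouplikeM g'G zG.
  have gz : g * (g' * z) = z by rewrite mulrA gg' mul1r.
  have [zY|zY] := boolP (z \in Y); have [zX|zX] := boolP (g' * z \in X) => //.
    case: nz; rewrite -(Pidem_mem YG zY) -act_grouplike_central // mulrA.
    rewrite -gz gPe Pidem_notin //; last exact/in_Gset.
    by rewrite [_ \dot _](linear0 (actr g)) mul0r.
  case: nz; rewrite -(Pidem_mem XG zX) -gPe gz -mulrA act_grouplike_central //.
  by rewrite Pidem_notin ?mulr0 //; exact/in_Gset.
exists g, g'; split=> //; try exact/in_Gset.
split; first by rewrite -[g']mulr1 -XY //; exact: grouplike1.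
apply/fsetP => z; apply/imfsetP/idP => /= [[x xX ->]|zY].
  have xG := (in_Gset x).1 (fsubsetP XG x xX).
  by rewrite XY ?mulrA ?g'g ?mul1r //; exact: grouplikeM.
have zG := (in_Gset z).1 (fsubsetP YG z zY).
by exists (g' * z); rewrite ?mulrA ?gg' ?mul1r // -XY.
Qed.

(** The products of [z \dot 1] or [1 - z \dot 1] over all [z] in [G] sum to 1.  To
    avoid expanding a product of sums, one removes the factors one by one:
    if [u] is killed by a product with either choice of one factor, it is killed by
    the product without that factor. *)
Lemma eq0_Pidem u : (forall X, (X `<=` G)%fset -> u * P X = 0) -> u = 0.
Proof.
move=> uP.
pose t (X : {fset H}) x := if x \in X then x \dot 1 else 1 - x \dot 1.
have tc X x : grouplike x -> central (t X x).
  by move=> /act_grouplike_central xc; rewrite /t; case: ifP => // _; exact: central1B.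
have tt X x : grouplike x -> t X x * t X x = t X x.
  move=> xG; have ex := act_grouplike_idem xG.
  by rewrite /t; case: ifP => // _; rewrite mulrBr mulr1 mulrBl mul1r ex subrr subr0.
have uQ X : (X `<=` G)%fset -> u * \prod_(x <- G) t X x = 0.
  move=> XG; set Q := \prod_(x <- _) _.
  have Qt x : x \in G -> Q * t X x = Q.
    move=> xG; have gx := (in_Gset x).1 xG.
    by apply: prod_absorb xG => [y /in_Gset|]; [exact: tc|exact: tt].
  have QP : Q * P X = Q.
    rewrite /Pidem mulrA [X in X * _]absorb_prod => [|x xX]; last first.
      by have := Qt x (fsubsetP XG x xX); rewrite /t xX.
    apply: absorb_prod => x; rewrite inE => /andP[xX xG].
    by have := Qt x xG; rewrite /t (negPf xX).
  by rewrite -QP -Pidem_central // mulrA uP // mul0r.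
have main s : uniq s -> (forall x, x \in s -> x \in G) ->
    (forall X, (X `<=` G)%fset -> u * \prod_(x <- s) t X x = 0) -> u = 0.
  elim: s => [_ _ /(_ fset0 (fsub0set _))|x s IHs /= /andP[xs us] sG us0].
    by rewrite big_nil mulr1.
  apply: IHs => // [y ys|X XG]; first by apply: sG; rewrite inE ys orbT.
  have xG : x \in G by apply: sG; rewrite inE eqxx.
  (* [X] with and without [x] give the two choices for the factor at [x]. *)
  have tE Z : (forall y, y \in s -> (y \in Z) = (y \in X)) ->
      \prod_(y <- s) t Z y = \prod_(y <- s) t X y.
    by move=> ZX; apply: eq_big_seq => y ys; rewrite /t ZX.
  have ynx y : y \in s -> y != x by apply: contraTneq => ->.
  have := us0 (x |` X)%fset; rewrite fsubUset fsub1set xG XG big_cons => /(_ isT).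
  have := us0 (X `\ x)%fset; rewrite big_cons.
  rewrite !tE => [|y /ynx yx|y /ynx yx]; try by rewrite !inE (negPf yx).
  move=> /(_ (fsubset_trans (fsubD1set _ _) XG)).
  rewrite /t !inE eqxx /= => u1 u2; have := congr2 +%R u1 u2.
  by rewrite addr0 !mulrBl mul1r mulrBr subrK.
exact: (main G (fset_uniq _)).
Qed.

Lemma sum_Pidem : \sum_(X <- fpowerset G) P X = 1.
Proof.
apply/eqP; rewrite eq_sym -subr_eq0; apply/eqP/eq0_Pidem => X XG.
rewrite mulrBl mul1r mulr_suml (bigD1_seq X) ?fpowersetE ?fset_uniq //= Pidem_idem //.
rewrite big_seq_cond big1 ?addr0 ?subrr // => Y.
by rewrite fpowersetE => /andP[YG YX]; exact: Pidem_orthogonal.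
Qed.

Lemma Gam_Pidem X Y : (Y `<=` G)%fset ->
  Gam act X * P Y = if `[< P1 Y /\ trans_equiv Y X >] then P Y else 0.
Proof.
move=> YG; rewrite /Gam big_mkcond mulr_suml (bigD1_seq Y) ?fpowersetE ?fset_uniq //=.
rewrite big_seq_cond big1 ?addr0 => [|Z].
  by case: ifP; rewrite ?mul0r ?Pidem_idem.
rewrite fpowersetE => /andP[ZG ZY].
by case: ifP; rewrite ?mul0r ?Pidem_orthogonal.
Qed.

Lemma Gam_central X : central (Gam act X).
Proof.
move=> a; rewrite /Gam mulr_suml mulr_sumr big_seq_cond [RHS]big_seq_cond.
by apply: eq_bigr => Y /andP[]; rewrite fpowersetE => YG _; exact: Pidem_central.
Qed.

Lemma Gam_idem X : Gam act X * Gam act X = Gam act X.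
Proof.
rewrite {2}/Gam mulr_sumr big_seq_cond [RHS]big_seq_cond.
by apply: eq_bigr => Y /andP[]; rewrite fpowersetE => YG YX; rewrite Gam_Pidem ?YX.
Qed.

Lemma Gam_orthogonal X Y :
  (forall Z, P1 Z -> trans_equiv Z X -> trans_equiv Z Y -> False) ->
  Gam act X * Gam act Y = 0.
Proof.
move=> XY; rewrite {2}/Gam mulr_sumr big_seq_cond big1 // => Z /andP[].
rewrite fpowersetE => ZG /asboolP[Z1 ZY]; rewrite Gam_Pidem //.
by case: asboolP => // -[_ /XY]; case.
Qed.

Lemma trans_equiv_refl (X : {fset H}) : 1 \in X -> trans_equiv X X.
Proof.
move=> X1; have G1 : 1 \in G by apply/in_Gset/grouplike1.
exists 1, 1; split; rewrite ?mulr1 //; split=> //.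
apply/fsetP => z; apply/imfsetP/idP => /= [[x xX ->]|zX]; first by rewrite mul1r.
by exists z; rewrite ?mul1r.
Qed.

(** Together with reflexivity, this form yields both symmetry and transitivity. *)
Lemma trans_equiv_eucl (X Y Z : {fset H}) : (X `<=` G)%fset ->
  trans_equiv X Y -> trans_equiv X Z -> trans_equiv Z Y.
Proof.
move=> XG [g [g' [gG g'G gg' g'g [g'X <-]]]] [k [k' [kG k'G kk' k'k [k'X <-]]]].
have /in_Gset gG' := gG; have /in_Gset g'G' := g'G.
have /in_Gset kG' := kG; have /in_Gset k'G' := k'G.
exists (g * k'), (k * g'); split; try by apply/in_Gset/grouplikeM.
- by rewrite mulrA -(mulrA g) k'k mulr1.
- by rewrite mulrA -(mulrA k) g'g mulr1.
split; first by apply/imfsetP; exists g'.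
apply/fsetP => z; apply/imfsetP/imfsetP => /=.
  move=> [_ /imfsetP[/= x xX ->] ->]; exists x => //.
  by rewrite mulrA -(mulrA g) k'k mulr1.
move=> [x xX ->]; exists (k * x); first by apply/imfsetP; exists x.
by rewrite mulrA -(mulrA g) k'k mulr1.
Qed.

Lemma one_sub_Gam X :
  1 - Gam act X = \sum_(Y <- fpowerset G | ~~ `[< P1 Y /\ trans_equiv Y X >]) P Y.
Proof.
rewrite -sum_Pidem (bigID (fun Y => `[< P1 Y /\ trans_equiv Y X >])) /=.
by rewrite -/(Gam act X) addrAC subrr add0r.
Qed.

(** Expand [Gam act X] and [1 - Gam act X] into the idempotents [P Y] and apply
    [act_Pidem_neq0] to pairs [Y], [Z] with [Y] in the class of [X] and [Z] outside:
    all the products vanish. *)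
Lemma act_Gam (Hpt : pointed H) X h : h \dot Gam act X = (h \dot 1) * Gam act X.
Proof.
have orth g Y Z : grouplike g -> Y \in fpowerset G -> Z \in fpowerset G ->
   (P1 Y /\ trans_equiv Y X) /\ ~ (P1 Z /\ trans_equiv Z X) ->
   (g \dot P Y) * P Z = 0 /\ (g \dot P Z) * P Y = 0.
  rewrite !fpowersetE => gG YG ZG [[Y1 YX] nZ].
  have [Z1|Z1] := boolP (1 \in Z); last first.
    by rewrite (Pidem_notin1 ZG Z1) mulr0 [_ \dot _](linear0 (actr g)) mul0r.
  have ZP1 : P1 Z by [].
  split; apply: contrapT => /act_Pidem_neq0 nz; apply: nZ; split=> //.
    by apply: (trans_equiv_eucl YG) => //; exact: nz.
  (* Here [Z ~ Y], which is first turned into [Y ~ Z]. *)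
  apply: (trans_equiv_eucl YG) => //; apply: (trans_equiv_eucl ZG).
    exact: trans_equiv_refl.
  exact: nz.
have GamE : Gam act X = \sum_(Y <- fpowerset G | `[< P1 Y /\ trans_equiv Y X >]) P Y.
  by [].
apply: act_complementary (1 - Gam act X) _ _ _ _ _ _ _ _ => //.
- exact: Gam_central.
- exact: Gam_idem.
- exact/central1B/Gam_central.
- by rewrite mulrBr mulr1 mulrBl mul1r Gam_idem subrr subr0.
- by rewrite addrC subrK.
move=> g gG; rewrite one_sub_Gam GamE; split.
  rewrite [_ \dot _](linear_sum (actr g)) mulr_suml big_seq_cond big1 // => Y.
  move=> /andP[YG /asboolP YX]; rewrite mulr_sumr big_seq_cond big1 // => Z.
  by move=> /andP[ZG /asboolPn ZX]; have [] := orth g Y Z.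
rewrite [_ \dot _](linear_sum (actr g)) mulr_suml big_seq_cond big1 // => Z.
move=> /andP[ZG /asboolPn ZX]; rewrite mulr_sumr big_seq_cond big1 // => Y.
by move=> /andP[YG /asboolP YX]; have [] := orth g Y Z.
Qed.

End PartialAction.

(** * The decomposition *)

Lemma sum_central_idempotents (R : nzRingType) n (e : 'I_n -> R) :
  (forall k, e k * e k = e k) -> (forall k l, k != l -> e k * e l = 0) ->
  \sum_k e k = 1 ->
  internal_direct_sum (fun k => [set a * e k | a in [set: R]]).
Proof.
move=> ee e0 e1 a; exists [ffun k => a * e k]; split.
  split=> [k|]; first by rewrite ffunE; exists a.
  by under eq_bigr do rewrite ffunE; rewrite -mulr_sumr e1 mulr1.
move=> b [be aE]; apply/ffunP => k; rewrite ffunE aE mulr_suml (bigD1 k) //=.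
rewrite big1 ?addr0 => [|l lk]; last first.
  by have [c _ <-] := be l; rewrite -mulrA e0 ?mulr0.
by have [c _ <-] := be k; rewrite -mulrA ee.
Qed.

Lemma central_ideal (R : nzRingType) (e : R) : central e ->
  [set a * e | a in [set: R]] = smallest (@two_sided_ideal R) [set e].
Proof.
move=> ec; rewrite eqEsubset; split.
  move=> _ [a _ <-] J [[_ _ JM] eJ].
  by have [] := JM a e (eJ e erefl).
apply: smallest_sub; last by move=> _ ->; exists 1; rewrite ?mul1r.
split; first by exists 0; rewrite ?mul0r.
  by move=> _ _ [a _ <-] [b _ <-]; exists (a - b); rewrite ?mulrBl.
move=> a _ [b _ <-]; split; first by exists (a * b); rewrite ?mulrA.
by exists (b * a); rewrite // -!mulrA ec.
Qed.

(** For [Y] in [P1], [Pidem act Y] is a term of exactly one [Gam act (X k)], and for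
    other [Y] it is zero; so [1 - \sum_k Gam act (X k)] is killed by all of them. *)
Lemma sum_Gam (K : fieldType) (H : hopfType K) (A : algType K)
    (act : {linear tensor H A -> A}) n (X : 'I_n -> {fset H}) :
  symmetric_partial_action act -> finite_set (@grouplike K H) ->
  complete_representatives X -> \sum_k Gam act (X k) = 1.
Proof.
move=> Hact Gfin [X1 XP]; apply/eqP; rewrite eq_sym -subr_eq0; apply/eqP.
apply: (eq0_Pidem Hact Gfin) => Y YG; rewrite mulrBl mul1r mulr_suml.
have [Y1|Y1] := boolP (1 \in Y); last first.
  rewrite (Pidem_notin1 Hact Gfin) // big1 ?subr0 // => k _; exact: mulr0.
have [k [YX kP]] := XP Y (conj YG Y1).
rewrite (bigD1 k) //= big1 ?addr0 => [|l lk]; rewrite (Gam_Pidem Hact Gfin) //.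
  by case: asboolP => [_|[]]; rewrite ?subrr.
by case: asboolP => // -[_ /kP kl]; rewrite kl eqxx in lk.
Qed.

Theorem theorem2p8 (K : fieldType) (H : hopfType K)
    (Hpointed : pointed H)
    (Hantipode : bijective (antipode : H -> H))
    (Gfin : finite_set (grouplike (C := H)))
    (A : algType K) (act : {linear tensor H A -> A})
    (Hact : symmetric_partial_action act) :
  (forall (n : nat) (X : 'I_n -> {fset H}), complete_representatives X ->
     let AGam (k : 'I_n) : set A := [set a * Gam act (X k) | a in [set: A]] in
     [/\ internal_direct_sum AGam,
         forall k, AGam k = smallest (@two_sided_ideal A) [set Gam act (X k)] &
         forall k (h : H) (a : A), AGam k a -> AGam k (act (h \ox a))]) /\
  (forall (X : {fset H}), P1 X -> forall (a : A) (h : H),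
     act (h \ox (a * Gam act X)) = act (h \ox a) * Gam act X).
Proof.
have actGam X a h : act (h \ox (a * Gam act X)) = act (h \ox a) * Gam act X.
  by apply: (act_mul_invariant Hact) => {}h; exact: act_Gam.
split=> [n X XP AGam|X _ a h]; last exact: actGam.
split=> [|k|k h _ [a _ <-]].
- apply: sum_central_idempotents => [k|k l kl|]; first exact: Gam_idem.
  + apply: (Gam_orthogonal Hact Gfin) => Z Z1 Zk Zl.
    have [m [_ mP]] := XP.2 Z Z1.
    by move/eqP: kl; apply; rewrite -(mP k Zk) -(mP l Zl).
  + exact: sum_Gam.
- by apply: central_ideal; exact: Gam_central.
- by rewrite actGam; exists (act (h \ox a)).
Qed.
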